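(* Let $\mathbb{V}\subseteq\mathbb{SDM}$ be a variety of semi-De Morgan algebras. The following are equivalent: (i) $\mathbb{V}$ is axiomatized by a finite set of equations; (ii) $\vdash^{\leq}_{\mathbb{V}}$ is axiomatized by a finite set of finitary (Hilbert) rule schemata.
   Context: Fix the language with binary connectives $\land,\lor$, unary $\neg$ and constants $\bot,\top$; $Fm$ is the set of formulas over a countably infinite set of variables. A distributive lattice with negation is an algebra $\langle A;\land,\lor,\neg,\bot,\top\rangle$ whose reduct $\langle A;\land,\lor,\bot,\top\rangle$ is a bounded distributive lattice and which satisfies $\neg\bot\approx\top$ and $\neg(x\lor y)\approx\neg x\land\neg y$. A semi-De Morgan algebra is a distributive lattice with negation satisfying moreover $\neg\top\approx\bot$, $\neg\neg(x\land y)\approx\neg\neg x\land\neg\neg y$ and $\neg x\approx\neg\neg\neg x$; $\mathbb{SDM}$ is the variety of semi-De Morgan algebras. For a class $\mathbb{K}$ of distributive lattices with negation, the order-preserving logic $\vdash^{\leq}_{\mathbb{K}}$ is given by: $\Gamma\vdash^{\leq}_{\mathbb{K}}\varphi$ iff for every $\mathbf{A}\in\mathbb{K}$, every non-empty lattice filter $F$ of $\mathbf{A}$ and every homomorphism $h\colon Fm\to A$, $h[\Gamma]\subseteq F$ implies $h(\varphi)\in F$. A finitary rule schema is a pair $\frac{\Gamma}{\varphi}$ with $\Gamma$ a finite (possibly empty) set of formulas; a set of rule schemata axiomatizes a logic if that logic coincides with derivability by Hilbert derivations using substitution instances of the rules. *)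

(* Defs.v *)
From Stdlib Require Import List.
Import ListNotations.

Set Implicit Arguments.

(** Plain algebras of type (2,2,1,0,0): no axioms are built in, so that classes
    of algebras, equations and the operators H, S, P have their usual
    universal-algebraic meaning. *)
Record algebra := Algebra {
  carrier :> Type;
  meet : carrier -> carrier -> carrier;
  join : carrier -> carrier -> carrier;
  neg : carrier -> carrier;
  bot : carrier;
  top : carrier
}.

Arguments meet {a} _ _.
Arguments join {a} _ _.
Arguments neg {a} _.
Arguments bot {a}.
Arguments top {a}.

Record is_hom (A B : algebra) (h : A -> B) : Prop := {
  hom_meet : forall x y, h (meet x y) = meet (h x) (h y);
  hom_join : forall x y, h (join x y) = join (h x) (h y);
  hom_neg : forall x, h (neg x) = neg (h x);
  hom_bot : h bot = bot;
  hom_top : h top = top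
}.

Record bounded_distributive_lattice (A : algebra) : Prop := {
  meetC : forall x y : A, meet x y = meet y x;
  joinC : forall x y : A, join x y = join y x;
  meetA : forall x y z : A, meet x (meet y z) = meet (meet x y) z;
  joinA : forall x y z : A, join x (join y z) = join (join x y) z;
  meetK : forall x y : A, meet x (join x y) = x;
  joinK : forall x y : A, join x (meet x y) = x;
  meet_joinr : forall x y z : A,
    meet x (join y z) = join (meet x y) (meet x z);
  join_bot : forall x : A, join x bot = x;
  meet_top : forall x : A, meet x top = x
}.

Record distributive_lattice_with_negation (A : algebra) : Prop := {
  dln_lattice : bounded_distributive_lattice A;
  neg_bot : neg bot = top :> A;
  neg_join : forall x y : A, neg (join x y) = meet (neg x) (neg y)
}.

Record semi_de_morgan (A : algebra) : Prop := {
  sdm_dln : distributive_lattice_with_negation A;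
  neg_top : neg top = bot :> A;
  neg_neg_meet : forall x y : A,
    neg (neg (meet x y)) = meet (neg (neg x)) (neg (neg y));
  neg_neg_neg : forall x : A, neg x = neg (neg (neg x))
}.

Definition product (I : Type) (A : I -> algebra) : algebra := {|
  carrier := forall i, A i;
  meet := fun x y i => meet (x i) (y i);
  join := fun x y i => join (x i) (y i);
  neg := fun x i => neg (x i);
  bot := fun i => bot;
  top := fun i => top
|}.

(** Closure under H, S and P, everything up to isomorphism: an isomorphic copy
    of a subalgebra of [A] is an algebra with an injective homomorphism into
    [A].  The index type of a product may be empty. *)
Record variety (V : algebra -> Prop) : Prop := {
  variety_H : forall (A B : algebra) (h : A -> B),
    is_hom A B h -> (forall b, exists a, h a = b) -> V A -> V B;
  variety_S : forall (A B : algebra) (h : B -> A),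
    is_hom B A h -> (forall x y, h x = h y -> x = y) -> V A -> V B;
  variety_P : forall (I : Type) (A : I -> algebra),
    (forall i, V (A i)) -> V (product A)
}.

Inductive form : Set :=
| Var : nat -> form
| And : form -> form -> form
| Or : form -> form -> form
| Neg : form -> form
| Bot : form
| Top : form.

Definition Fm : algebra := {|
  carrier := form;
  meet := And;
  join := Or;
  neg := Neg;
  bot := Bot;
  top := Top
|}.

Definition equation : Type := form * form.

Definition satisfies (A : algebra) (e : equation) : Prop :=
  forall h : Fm -> A, is_hom Fm A h -> h (fst e) = h (snd e).

Definition axiomatized_by_equations
    (V : algebra -> Prop) (E : equation -> Prop) : Prop :=
  forall A, V A <-> (forall e, E e -> satisfies A e).

Definition finitely_based (V : algebra -> Prop) : Prop :=
  exists E : list equation, axiomatized_by_equations V (fun e => In e E).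

(** The lattice order is [x <= y] iff [meet x y = x].  Filters may be
    improper. *)
Record nonempty_lattice_filter (A : algebra) (F : A -> Prop) : Prop := {
  filter_nonempty : exists x, F x;
  filter_meet : forall x y, F x -> F y -> F (meet x y);
  filter_up : forall x y, F x -> meet x y = x -> F y
}.

Definition consequence : Type := (form -> Prop) -> form -> Prop.

Definition order_preserving_logic (K : algebra -> Prop) : consequence :=
  fun Gamma phi =>
    forall A : algebra, K A ->
    forall F : A -> Prop, nonempty_lattice_filter A F ->
    forall h : Fm -> A, is_hom Fm A h ->
      (forall gamma, Gamma gamma -> F (h gamma)) -> F (h phi).

Record rule : Type := Rule { premises : list form; conclusion : form }.

(** The lines of a derivation are listed from the last to the first.  A
    substitution is an endomorphism of [Fm]. *)
Inductive derivation (R : rule -> Prop) (Gamma : form -> Prop) :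
    list form -> Prop :=
| derivation_nil : derivation R Gamma []
| derivation_premise (s : list form) (phi : form) :
    derivation R Gamma s -> Gamma phi -> derivation R Gamma (phi :: s)
| derivation_rule (s : list form) (r : rule) (sigma : form -> form) :
    derivation R Gamma s -> R r -> is_hom Fm Fm sigma ->
    (forall psi, In psi (premises r) -> In (sigma psi) s) ->
    derivation R Gamma (sigma (conclusion r) :: s).

Definition derivable (R : rule -> Prop) : consequence :=
  fun Gamma phi => exists s, derivation R Gamma (phi :: s).

Definition axiomatized_by_rules (L : consequence) (R : rule -> Prop) : Prop :=
  forall Gamma phi, L Gamma phi <-> derivable R Gamma phi.

Definition finitely_axiomatizable (L : consequence) : Prop :=
  exists R : list rule, axiomatized_by_rules L (fun r => In r R).

(* Main.v *)
(** From equations to rules: the only obstacle to turning the inequalities of [V]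
    into Hilbert rules is that derivability must respect replacement of equals in
    arbitrary contexts.  In a semi-De Morgan algebra [~(x /\ d)] depends on [x]
    only through [~~x], so every one-hole context is equivalent to a meet of
    parameters and contexts of three shapes: [x \/ e], [~(x /\ d) \/ e] and
    [~(~x /\ d) \/ e].  It is therefore enough to state finitely many rules that
    reduce contexts to these shapes, and to state each equation of the basis
    inside each of the three.  Given a theory [T], the formulas that [T] does not
    distinguish in such contexts form a congruence whose quotient lies in [V] and
    in which [T] is a filter.

    From rules to equations: every rule [Gamma / phi] yields the equation
    [/\ Gamma <= phi].  Together with the semi-De Morgan equations these define a
    class in which the rules are sound, hence in which all equations of [V] hold,
    and Birkhoff's theorem applies. *)

From Stdlib Require Import List Classical ClassicalEpsilon.
From Stdlib Require Import FunctionalExtensionality PropExtensionality.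
Require Import Defs.
Import ListNotations.

Set Implicit Arguments.

(** * Terms and homomorphisms *)

Lemma hom_comp (A B C : algebra) (f : A -> B) (g : B -> C) :
  is_hom A B f -> is_hom B C g -> is_hom A C (fun x => g (f x)).
Proof.
intros [fm fj fn fb ft] [gm gj gn gb gt].
split; intros; rewrite ?fm, ?fj, ?fn, ?fb, ?ft; auto.
Qed.

Fixpoint interp (A : algebra) (v : nat -> A) (phi : form) : A :=
  match phi with
  | Var n => v n
  | And p q => meet (interp A v p) (interp A v q)
  | Or p q => join (interp A v p) (interp A v q)
  | Neg p => neg (interp A v p)
  | Bot => bot
  | Top => top
  end.

Lemma interp_hom (A : algebra) (v : nat -> A) : is_hom Fm A (interp A v).
Proof. now split. Qed.

Lemma hom_interp (A : algebra) (v : nat -> A) (h : Fm -> A) (phi : form) :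
  is_hom Fm A h -> (forall n, h (Var n) = v n) -> h phi = interp A v phi.
Proof.
intros [hm hj hn hb ht] hv; induction phi; simpl; auto.
- rewrite <- IHphi1, <- IHphi2; apply hm.
- rewrite <- IHphi1, <- IHphi2; apply hj.
- rewrite <- IHphi; apply hn.
Qed.

(** Birkhoff's theorem uses terms over the elements of an arbitrary algebra, whereas [form] has only
    countably many variables. *)
Inductive term (X : Type) : Type :=
| tvar : X -> term X
| tmeet : term X -> term X -> term X
| tjoin : term X -> term X -> term X
| tneg : term X -> term X
| tbot : term X
| ttop : term X.

Arguments tbot {X}.
Arguments ttop {X}.

Definition term_algebra (X : Type) : algebra := {|
  carrier := term X;
  meet := @tmeet X;
  join := @tjoin X;
  neg := @tneg X;
  bot := tbot;
  top := ttop
|}.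

Fixpoint eval (X : Type) (A : algebra) (v : X -> A) (t : term X) : A :=
  match t with
  | tvar x => v x
  | tmeet s t => meet (eval A v s) (eval A v t)
  | tjoin s t => join (eval A v s) (eval A v t)
  | tneg s => neg (eval A v s)
  | tbot => bot
  | ttop => top
  end.

Lemma eval_hom (X : Type) (A : algebra) (v : X -> A) :
  is_hom (term_algebra X) A (eval A v).
Proof. now split. Qed.

Lemma hom_eval (X : Type) (A B : algebra) (v : X -> A) (h : A -> B) (t : term X) :
  is_hom A B h -> h (eval A v t) = eval B (fun x => h (v x)) t.
Proof.
intros [hm hj hn hb ht]; induction t; simpl; auto.
- now rewrite hm, IHt1, IHt2.
- now rewrite hj, IHt1, IHt2.
- now rewrite hn, IHt.
Qed.

Fixpoint vars (X : Type) (t : term X) : list X :=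
  match t with
  | tvar x => [x]
  | tmeet s t => vars s ++ vars t
  | tjoin s t => vars s ++ vars t
  | tneg s => vars s
  | tbot => []
  | ttop => []
  end.

Lemma eval_ext (X : Type) (A : algebra) (v w : X -> A) (t : term X) :
  (forall x, In x (vars t) -> v x = w x) -> eval A v t = eval A w t.
Proof.
induction t; simpl; intros H; auto.
- rewrite IHt1, IHt2; auto; intros x Hx; apply H, in_or_app; auto.
- rewrite IHt1, IHt2; auto; intros x Hx; apply H, in_or_app; auto.
- rewrite IHt; auto.
Qed.

(** * Quotients and Birkhoff's theorem *)

Record congruence (A : algebra) (R : A -> A -> Prop) : Prop := {
  cong_refl : forall x, R x x;
  cong_sym : forall x y, R x y -> R y x;
  cong_trans : forall x y z, R x y -> R y z -> R x z;
  cong_meet : forall x x' y y', R x x' -> R y y' -> R (meet x y) (meet x' y');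
  cong_join : forall x x' y y', R x x' -> R y y' -> R (join x y) (join x' y');
  cong_neg : forall x x', R x x' -> R (neg x) (neg x')
}.

(** Classes are the predicates [R a], equal for related elements by extensionality; the operations
    act on chosen representatives. *)
Lemma quotient_exists (A : algebra) (R : A -> A -> Prop) : congruence A R ->
  exists (Q : algebra) (q : A -> Q), is_hom A Q q /\
    (forall c, exists a, q a = c) /\ (forall x y, q x = q y <-> R x y).
Proof.
intros [Rr Rs Rt Rm Rj Rn].
set (C := {P : A -> Prop | exists a, P = R a}).
set (cls := fun a => exist _ (R a) (ex_intro _ a eq_refl) : C).
assert (clsE : forall x y, cls x = cls y <-> R x y).
{ intros x y; split; intros H.
  - apply (f_equal (@proj1_sig _ _)) in H; simpl in H; rewrite H; apply Rr.
  - apply eq_sig_hprop; [intros; apply proof_irrelevance|]; simpl.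
    apply functional_extensionality; intros z; apply propositional_extensionality.
    split; intros; eauto. }
assert (surj : forall c, exists a, cls a = c).
{ intros [P [a ->]]; now exists a. }
set (rep := fun c => proj1_sig (constructive_indefinite_description _ (surj c))).
assert (repK : forall a, R a (rep (cls a))).
{ intros a; apply clsE; unfold rep.
  destruct constructive_indefinite_description; auto. }
exists (Algebra (fun c c' => cls (meet (rep c) (rep c')))
  (fun c c' => cls (join (rep c) (rep c'))) (fun c => cls (neg (rep c)))
  (cls bot) (cls top)), cls.
repeat split; simpl; intros; auto; try apply clsE; auto.
Qed.

(** The term algebra over [A], modulo the identities of [V], embeds into a product of members of [V]
    and maps onto [A]. *)
Lemma birkhoff (V : algebra -> Prop) (A : algebra) : variety V ->
  (forall e, (forall B, V B -> satisfies B e) -> satisfies A e) -> V A.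
Proof.
intros [VH VS VP] HA.
set (R := fun s t : term A =>
  forall B, V B -> forall v : A -> B, eval B v s = eval B v t).
assert (cR : congruence (term_algebra A) R).
{ split; unfold R; simpl; intros; auto; rewrite H, ?H0; auto. }
destruct (quotient_exists cR) as (Q & q & hq & surj & qE).
assert (VQ : V Q).
(* Indexing the product by separated pairs of terms, one chosen witness for each,
   keeps it in the universe of [algebra]. *)
{ set (I := {p : term A * term A | ~ R (fst p) (snd p)}).
  assert (wit : forall i : I, exists B : {B : algebra & A -> B},
    V (projT1 B) /\ eval _ (projT2 B) (fst (proj1_sig i)) <>
                    eval _ (projT2 B) (snd (proj1_sig i))).
  { intros [[s t] H]; simpl in *; apply NNPP; intros N; apply H.
    intros B VB v; apply NNPP; intros E; apply N.
    now exists (existT _ B v). }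
  set (w := fun i => proj1_sig (constructive_indefinite_description _ (wit i))).
  assert (wP : forall i, V (projT1 (w i)) /\
    eval _ (projT2 (w i)) (fst (proj1_sig i)) <>
    eval _ (projT2 (w i)) (snd (proj1_sig i))).
  { intros i; unfold w; now destruct constructive_indefinite_description. }
  set (rep := fun c => proj1_sig (constructive_indefinite_description _ (surj c))).
  assert (repK : forall c, q (rep c) = c).
  { intros c; unfold rep; now destruct constructive_indefinite_description. }
  set (g := fun (c : Q) (i : I) => eval (projT1 (w i)) (projT2 (w i)) (rep c)).
  assert (gq : forall t, g (q t) = fun i => eval _ (projT2 (w i)) t).
  { intros t; apply functional_extensionality_dep; intros i; unfold g.
    apply (proj1 (qE _ _) (repK (q t))), wP. }
  apply (VS (product (fun i => projT1 (w i))) Q g).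
  - destruct hq as [hm hj hn hb ht].
    split; try (intros x; destruct (surj x) as [s <-]);
      try (intros y; destruct (surj y) as [t <-]);
      rewrite <- ?hm, <- ?hj, <- ?hn, <- ?hb, <- ?ht, ?gq; reflexivity.
  - intros x y; destruct (surj x) as [s <-], (surj y) as [t <-].
    rewrite !gq; intros E; apply qE, NNPP; intros N.
    set (i := exist _ (s, t) N : I).
    apply (proj2 (wP i)); exact (f_equal (fun f => f i) E).
  - apply VP; intros i; apply wP. }
(* [s] and [t] mention finitely many elements of [A]. Replacing each by a position in the list [l]
   gives an equation between formulas that is valid in [V], hence in [A]. *)
assert (evA : forall s t, R s t -> eval A (fun a => a) s = eval A (fun a => a) t).
{ intros s t Rst.
  set (l := vars s ++ vars t).
  assert (index : forall a, exists n, In a l -> nth n l bot = a).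
  { intros a; destruct (classic (In a l)) as [H|H].
    - destruct (In_nth l a bot H) as (n & _ & E); now exists n.
    - now exists 0. }
  set (r := fun a => proj1_sig (constructive_indefinite_description _ (index a))).
  assert (rK : forall a, In a l -> nth (r a) l bot = a).
  { intros a; unfold r; now destruct constructive_indefinite_description. }
  assert (back : forall u, incl (vars u) l ->
    interp A (fun n => nth n l bot) (eval Fm (fun a => Var (r a)) u) =
    eval A (fun a => a) u).
  { intros u Hu; rewrite (hom_eval _ _ (interp_hom A _)); simpl.
    apply eval_ext; intros a Ha; apply rK, Hu, Ha. }
  rewrite <- (back s), <- (back t).
  - apply (HA (eval Fm (fun a => Var (r a)) s, eval Fm (fun a => Var (r a)) t));
      [|apply interp_hom].
    intros B VB h hh; simpl; rewrite !(hom_eval _ _ hh); apply Rst, VB.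
  - intros a Ha; apply in_or_app; auto.
  - intros a Ha; apply in_or_app; auto. }
set (rep := fun c => proj1_sig (constructive_indefinite_description _ (surj c))).
assert (repK : forall c, q (rep c) = c).
{ intros c; unfold rep; now destruct constructive_indefinite_description. }
set (g := fun c : Q => eval A (fun a => a) (rep c)).
assert (gq : forall t, g (q t) = eval A (fun a => a) t).
{ intros t; apply evA, qE, repK. }
apply (VH Q A g); auto.
- destruct hq as [hm hj hn hb ht].
  split; try (intros x; destruct (surj x) as [s <-]);
    try (intros y; destruct (surj y) as [t <-]);
    rewrite <- ?hm, <- ?hj, <- ?hn, <- ?hb, <- ?ht, ?gq; reflexivity.
- intros a; exists (q (tvar a)); now rewrite gq.
Qed.

(** * Derivations and filters *)

Definition closed_under (R : rule -> Prop) (T : form -> Prop) : Prop :=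
  forall r sigma, R r -> is_hom Fm Fm sigma ->
    (forall psi, In psi (premises r) -> T (sigma psi)) -> T (sigma (conclusion r)).

Lemma derivation_app (R : rule -> Prop) (Gamma : form -> Prop) (s t : list form) :
  derivation R Gamma s -> derivation R Gamma t -> derivation R Gamma (s ++ t).
Proof.
intros Hs Ht; induction Hs; simpl; auto.
- now apply derivation_premise.
- apply derivation_rule; auto; intros psi Hpsi; apply in_or_app; auto.
Qed.

Lemma derivation_derivable (R : rule -> Prop) (Gamma : form -> Prop) (l : list form) :
  (forall phi, In phi l -> derivable R Gamma phi) ->
  exists s, derivation R Gamma s /\ incl l s.
Proof.
induction l as [|phi l IH]; intros H.
- exists []; split; [constructor|intros x []].
- destruct IH as (s & Hs & Is); [intros; apply H; now right|].
  destruct (H phi) as [t Ht]; [now left|].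
  exists ((phi :: t) ++ s); split; [now apply derivation_app|].
  intros x [<-|Hx]; [now left|]; apply in_or_app; auto.
Qed.

(** Separate derivations of the finitely many premises concatenate into one, to which the rule then
    applies. *)
Lemma derivable_closed (R : rule -> Prop) (Gamma : form -> Prop) :
  closed_under R (derivable R Gamma).
Proof.
intros r sigma Rr hs H.
destruct (derivation_derivable (R := R) (Gamma := Gamma) (map sigma (premises r)))
  as (s & Hs & Is).
- intros phi Hphi; apply in_map_iff in Hphi; destruct Hphi as (psi & <- & Hpsi); auto.
- exists s; apply derivation_rule; auto; intros psi Hpsi; now apply Is, in_map.
Qed.

Lemma derivable_premise (R : rule -> Prop) (Gamma : form -> Prop) (phi : form) :
  Gamma phi -> derivable R Gamma phi.
Proof. intros H; exists []; apply derivation_premise; auto; constructor. Qed.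

Lemma derivable_least (R : rule -> Prop) (Gamma T : form -> Prop) (phi : form) :
  closed_under R T -> (forall psi, Gamma psi -> T psi) -> derivable R Gamma phi -> T phi.
Proof.
intros HT HG [s Hs].
assert (H : forall psi, In psi (phi :: s) -> T psi).
{ induction Hs; intros psi Hpsi; [destruct Hpsi| |];
    destruct Hpsi as [<-|Hpsi]; auto. }
apply H; now left.
Qed.

Definition conjunction (l : list form) : form := fold_right And Top l.

(** * Lattice filters and finite conjunctions *)

Section Filters.

Variables (A : algebra) (hA : bounded_distributive_lattice A).

Lemma meet_idem (x : A) : meet x x = x.
Proof. rewrite <- (joinK hA x x) at 2; apply (meetK hA). Qed.

Lemma principal_filter (a : A) : nonempty_lattice_filter A (fun x => meet a x = a).
Proof.
split.
- exists a; apply meet_idem.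
- intros x y Hx Hy; now rewrite (meetA hA), Hx.
- intros x y Hx Hxy; now rewrite <- Hx, <- (meetA hA), Hxy.
Qed.

Variables (F : A -> Prop) (hF : nonempty_lattice_filter A F).

Lemma filter_top : F top.
Proof.
destruct (filter_nonempty hF) as [x Fx].
apply (filter_up hF _ Fx), (meet_top hA).
Qed.

Lemma filter_meetE (x y : A) : F (meet x y) <-> F x /\ F y.
Proof.
split; [intros H; split; apply (filter_up hF _ H)|intros [Fx Fy]; now apply (filter_meet hF)].
- now rewrite (meetC hA), (meetA hA), meet_idem.
- now rewrite <- (meetA hA), meet_idem.
Qed.

Lemma filter_conj (h : Fm -> A) (l : list form) : is_hom Fm A h ->
  (F (h (conjunction l)) <-> forall psi, In psi l -> F (h psi)).
Proof.
intros hh; induction l as [|phi l IH]; simpl.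
- split; [now intros|intros _; rewrite (hom_top hh : h Top = top); apply filter_top].
- change (And phi (conjunction l)) with (meet (phi : Fm) (conjunction l)).
  rewrite (hom_meet hh), filter_meetE, IH; split.
  + intros [H1 H2] psi [<-|H]; auto.
  + intros H; auto.
Qed.

End Filters.

(** * From rules to equations *)

Definition sdm_equations : list equation :=
  let x := Var 0 in let y := Var 1 in let z := Var 2 in
  [ (And x y, And y x); (Or x y, Or y x);
    (And x (And y z), And (And x y) z); (Or x (Or y z), Or (Or x y) z);
    (And x (Or x y), x); (Or x (And x y), x);
    (And x (Or y z), Or (And x y) (And x z)); (Or x Bot, x); (And x Top, x);
    (Neg Bot, Top); (Neg (Or x y), And (Neg x) (Neg y)); (Neg Top, Bot);
    (Neg (Neg (And x y)), And (Neg (Neg x)) (Neg (Neg y)));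
    (Neg x, Neg (Neg (Neg x))) ].

Lemma satisfies_interp (A : algebra) (e : equation) :
  satisfies A e <-> forall v, interp A v (fst e) = interp A v (snd e).
Proof.
split; intros H; [intros v; apply H, interp_hom|].
intros h hh; rewrite !(hom_interp (fun n => h (Var n)) _ hh); auto.
Qed.

Lemma sdm_equationsP (A : algebra) :
  (forall e, In e sdm_equations -> satisfies A e) <-> semi_de_morgan A.
Proof.
split.
- intros H.
  assert (H' : forall e, In e sdm_equations -> forall x y z : A,
    interp A (fun n => nth n [x; y; z] bot) (fst e) =
    interp A (fun n => nth n [x; y; z] bot) (snd e)).
  { intros e He x y z; now apply (proj1 (satisfies_interp A e)), H. }
  clear H; rewrite <- Forall_forall in H'; unfold sdm_equations in H'.
  repeat match goal with
  | H : Forall _ (_ :: _) |- _ => 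
      let H1 := fresh in let H2 := fresh in
      inversion_clear H as [|? ? H1 H2]; simpl in H1
  end.
  repeat split; intros;
    (* Laws in fewer than three variables leave the others undetermined; these are set to [bot]. *)
    match goal with H : _ |- _ => solve [unshelve eapply H; exact bot] end.
- intros [[[] ? ?] ? ? ?] e He; apply (proj2 (satisfies_interp A _)); intros v.
  simpl in He; repeat (destruct He as [<-|He]; [simpl; auto|]); destruct He.
Qed.

Definition rule_equation (r : rule) : equation :=
  (And (conjunction (premises r)) (conclusion r), conjunction (premises r)).

Lemma finitely_based_of_axiomatizable (V : algebra -> Prop) : variety V ->
  (forall A : algebra, V A -> semi_de_morgan A) ->
  finitely_axiomatizable (order_preserving_logic V) -> finitely_based V.
Proof.
intros hV hSDM [R HR].
assert (lattice : forall A, semi_de_morgan A -> bounded_distributive_lattice A).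
{ intros A hA; apply hA. }
exists (sdm_equations ++ map rule_equation R); intros A; split.
- intros VA e He; apply in_app_or in He; destruct He as [He|He].
  { now apply sdm_equationsP; [apply hSDM|]. }
  apply in_map_iff in He; destruct He as (r & <- & Hr); intros h hh.
  assert (L := lattice A (hSDM A VA)).
  assert (D : derivable (fun r => In r R) (fun psi => In psi (premises r)) (conclusion r)).
  { apply (derivable_closed (R := fun r => In r R) r (sigma := fun phi => phi) Hr);
      [now split|].
    intros; now apply derivable_premise. }
  (* Tested on the principal filter of the value of the conjoined premises, the entailment [D] is
     exactly the required equation. *)
  apply HR in D; simpl; rewrite (hom_meet hh).
  apply (D A VA _ (principal_filter L _) h hh).
  apply (filter_conj L (principal_filter L _) _ hh), (meet_idem L).
- intros HA; apply birkhoff; auto; intros [s t] Hst h hh; simpl.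
  assert (L : bounded_distributive_lattice A).
  { apply lattice, sdm_equationsP; intros e He; apply HA, in_or_app; auto. }
  (* The rules preserve the filter generated by [h s], and [t] is derivable from [s] because the two
     agree throughout [V]; hence [h t] is above [h s]. *)
  assert (le : forall s t, (forall B, V B -> satisfies B (s, t)) ->
    meet (h s) (h t) = h s).
  { clear s t Hst; intros s t Hst.
    apply (derivable_least (R := fun r => In r R) (Gamma := eq s) (T :=
             fun phi => meet (h s) (h phi) = h s)).
    - intros r sigma Hr hs Hp.
      assert (hc := hom_comp hs hh).
      apply (filter_up (principal_filter L (h s)) _ (x := h (sigma (conjunction (premises r))))).
      + now apply (filter_conj L (principal_filter L (h s)) _ hc).
      + rewrite <- (hom_meet hc).
        refine (HA (rule_equation r) _ _ hc).
        apply in_or_app; right; now apply in_map.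
    - intros psi <-; apply (meet_idem L).
    - apply HR; intros B VB F hF g hg Hs.
      rewrite <- (Hst B VB g hg : g s = g t); apply Hs; reflexivity. }
  rewrite <- (le s t), (meetC L); auto.
  apply le; intros B VB g hg; symmetry; now apply (Hst B VB).
Qed.

(** * From equations to rules *)

(** A law [(c, l)] stands for the rule [l / c] together with the rules [c / psi]
    for [psi] in [l]. *)
Definition law : Type := form * list form.

Definition law_rules (w : law) : list rule :=
  Rule (snd w) (fst w) :: map (Rule [fst w]) (snd w).

Definition law_valid (A : algebra) (w : law) : Prop :=
  satisfies A (fst w, conjunction (snd w)).

(** The first three laws make a theory contain [Top], split meets, and be testable in the context
    [Or x Bot]. The others strip one connective from around the hole [x], leaving contexts of the
    three shapes. *)
Definition context_laws : list law :=
  let x := Var 0 in let c := Var 1 in let d := Var 2 in let e := Var 3 in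
  [ (Top, []);
    (And x c, [x; c]);
    (Or x Bot, [x]);
    (Or (Or x c) e, [Or x (Or c e)]);
    (Or (And x c) e, [Or x e; Or c e]);
    (Or (Neg x) e, [Or (Neg (And x Top)) e]);
    (Or (Neg (And (Or x c) d)) e, [Or (Neg (And x d)) e; Or (Neg (And c d)) e]);
    (Or (Neg (And (And x c) d)) e, [Or (Neg (And x (And c d))) e]);
    (Or (Neg (And (Neg (Neg x)) d)) e, [Or (Neg (And x d)) e]);
    (Or (Neg (And (Neg (Or x c)) d)) e,
       [Or (Neg (And (Neg x) (And (Neg c) d))) e]);
    (Or (Neg (And (Neg (And x c)) d)) e,
       [Or (Neg (And (Neg x) d)) e; Or (Neg (And (Neg c) d)) e]) ].

(** Frees the variables 0 and 1 for the context parameters [d] and [e]. *)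
Definition shift : form -> form := interp Fm (fun n => Var (S (S n))).

Definition equation_laws (q : equation) : list law :=
  let a := shift (fst q) in let b := shift (snd q) in
  let d := Var 0 in let e := Var 1 in
  [ (Or a e, [Or b e]);
    (Or (Neg (And a d)) e, [Or (Neg (And b d)) e]);
    (Or (Neg (And (Neg a) d)) e, [Or (Neg (And (Neg b) d)) e]) ].

(** * Validity of the laws in semi-De Morgan algebras *)

Section SemiDeMorgan.

Variables (A : algebra) (hA : semi_de_morgan A).

Let L : bounded_distributive_lattice A := dln_lattice (sdm_dln hA).

(** A negation equals its own double negation, and double negation distributes over meets. *)
Lemma neg_meet_neg_neg (x y z : A) : neg (neg x) = neg (neg y) ->
  neg (meet x z) = neg (meet y z).
Proof.
intros E; rewrite (neg_neg_neg hA (meet x z)), (neg_neg_neg hA (meet y z)).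
now rewrite !(neg_neg_meet hA), E.
Qed.

Lemma meet_joinl (x y z : A) : meet (join x y) z = join (meet x z) (meet y z).
Proof. now rewrite (meetC L), (meet_joinr L), (meetC L z x), (meetC L z y). Qed.

Lemma join_meetl (x y e : A) : join (meet x y) e = meet (join x e) (join y e).
Proof.
rewrite (meet_joinr L), meet_joinl, (meetC L (join x e) e), (joinC L x e), (meetK L).
now rewrite <- (joinA L), (joinC L (meet e y) e), (joinK L).
Qed.

Lemma neg_meet_join (x y z : A) :
  neg (meet (join x y) z) = meet (neg (meet x z)) (neg (meet y z)).
Proof. rewrite meet_joinl; apply (neg_join (sdm_dln hA)). Qed.

Lemma context_laws_valid (w : law) : In w context_laws -> law_valid A w.
Proof.
intros Hw; apply (proj2 (satisfies_interp A _)); intros v.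
simpl in Hw; repeat (destruct Hw as [<-|Hw]; [simpl; rewrite ?(meet_top L)|]);
  try destruct Hw; rewrite <- ?(meetA L), <- ?(joinA L); auto.
- apply (join_bot L).
- apply join_meetl.
- now rewrite neg_meet_join, join_meetl.
- f_equal; apply neg_meet_neg_neg; symmetry; apply (neg_neg_neg hA).
- now rewrite (neg_join (sdm_dln hA)), <- (meetA L).
(* A weak De Morgan law: [neg (meet x c)] and [join (neg x) (neg c)] have the same double negation,
   so they are interchangeable here. *)
- rewrite <- join_meetl, <- neg_meet_join; f_equal; apply neg_meet_neg_neg.
  now rewrite <- (neg_neg_neg hA), (neg_join (sdm_dln hA)), <- (neg_neg_meet hA),
    <- (neg_neg_neg hA).
Qed.

Lemma equation_laws_valid (q : equation) (w : law) :
  satisfies A q -> In w (equation_laws q) -> law_valid A w.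
Proof.
intros Hq Hw; apply (proj2 (satisfies_interp A _)); intros v.
assert (E : interp A v (shift (fst q)) = interp A v (shift (snd q))).
{ apply (Hq (fun phi => interp A v (shift phi))).
  apply (hom_comp (B := Fm)); apply interp_hom. }
simpl in Hw; repeat (destruct Hw as [<-|Hw]; [simpl; rewrite (meet_top L), E; auto|]).
destruct Hw.
Qed.

End SemiDeMorgan.

(** The rules of a law run both ways, which gives an equivalence. The fold reduces by [simpl] to an
    explicit conjunction, convenient for rewriting. *)
Lemma law_rules_closed (W : list law) (T : form -> Prop) :
  closed_under (fun r => In r (flat_map law_rules W)) T ->
  forall c l, In (c, l) W -> forall v : nat -> form,
  T (interp Fm v c) <-> fold_right (fun psi P => T (interp Fm v psi) /\ P) True l.
Proof.
intros HT c l Hw v.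
transitivity (forall psi, In psi l -> T (interp Fm v psi)).
- split.
  + intros Hc psi Hpsi.
    apply (HT (Rule [c] psi) (interp Fm v)); [|apply interp_hom|].
    * apply in_flat_map; exists (c, l); split; auto; right; simpl; now apply in_map.
    * intros chi [<-|[]]; exact Hc.
  + apply (HT (Rule l c) (interp Fm v)); [|apply interp_hom].
    apply in_flat_map; exists (c, l); split; auto; now left.
- clear; induction l as [|phi l IH]; simpl; [intuition|].
  rewrite <- IH; split; [intros H; split; auto|].
  intros [H1 H2] psi [<-|H]; auto.
Qed.

(** For [T] closed under the rules below, this is the Leibniz congruence of [T], the largest
    congruence compatible with it. *)
Definition indiscernible (T : form -> Prop) (phi psi : form) : Prop :=
  (forall e, T (Or phi e) <-> T (Or psi e)) /\
  (forall d e, T (Or (Neg (And phi d)) e) <-> T (Or (Neg (And psi d)) e)) /\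
  (forall d e, T (Or (Neg (And (Neg phi) d)) e) <-> T (Or (Neg (And (Neg psi) d)) e)).

(** * The quotient of the formula algebra by indiscernibility *)

Section Indiscernibility.

Variables (E : list equation) (T : form -> Prop).

(** [context_laws] only treat a hole on the left, hence the commutativity equations. *)
Definition laws : list law :=
  context_laws ++
  flat_map equation_laws
    ((And (Var 0) (Var 1), And (Var 1) (Var 0)) ::
     (Or (Var 0) (Var 1), Or (Var 1) (Var 0)) :: E).

Hypothesis hT : closed_under (fun r => In r (flat_map law_rules laws)) T.

Lemma context_laws_hold : Forall (fun w => forall x c d e,
  let u := interp Fm (fun n => nth n [x; c; d; e] Bot) in
  T (u (fst w)) <-> fold_right (fun psi P => T (u psi) /\ P) True (snd w))
  context_laws.
Proof.
apply Forall_forall; intros [a l] H x c d e.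
apply (law_rules_closed laws hT), in_or_app; auto.
Qed.

(** The three laws attached to an equation match the three clauses of [indiscernible]. *)
Lemma equation_indiscernible (q : equation) (v : nat -> form) :
  In q ((And (Var 0) (Var 1), And (Var 1) (Var 0)) ::
        (Or (Var 0) (Var 1), Or (Var 1) (Var 0)) :: E) ->
  indiscernible T (interp Fm v (fst q)) (interp Fm v (snd q)).
Proof.
intros Hq.
(* The parameters go to the two variables freed by [shift]; shifted formulas keep their value under
   [v]. *)
set (w := fun d e n => match n with 0 => d | 1 => e | S (S m) => v m end).
assert (wE : forall d e phi, interp Fm (w d e) (shift phi) = interp Fm v phi).
{ intros d e phi.
  apply (hom_interp (A := Fm) v (h := fun psi => interp Fm (w d e) (shift psi))); auto.
  apply (hom_comp (B := Fm)); apply interp_hom. }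
assert (H : forall c psi, In (c, [psi]) (equation_laws q) -> forall d e,
  T (interp Fm (w d e) c) <-> T (interp Fm (w d e) psi)).
{ intros c psi Hc d e.
  rewrite (law_rules_closed laws hT c [psi]); [simpl; tauto|].
  apply in_or_app; right; apply in_flat_map; eauto. }
assert (Ha : forall d e,
  (T (Or (interp Fm v (fst q)) e) <-> T (Or (interp Fm v (snd q)) e)) /\
  (T (Or (Neg (And (interp Fm v (fst q)) d)) e) <->
   T (Or (Neg (And (interp Fm v (snd q)) d)) e)) /\
  (T (Or (Neg (And (Neg (interp Fm v (fst q))) d)) e) <->
   T (Or (Neg (And (Neg (interp Fm v (snd q))) d)) e))).
{ intros d e; rewrite <- (wE d e (fst q)), <- (wE d e (snd q)).
  assert (H0 := H _ _ (or_introl eq_refl) d e).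
  assert (H1 := H _ _ (or_intror (or_introl eq_refl)) d e).
  assert (H2 := H _ _ (or_intror (or_intror (or_introl eq_refl))) d e).
  exact (conj H0 (conj H1 H2)). }
split; [|split]; intros; now apply Ha.
Qed.

Lemma indiscernible_congruence : congruence Fm (indiscernible T).
Proof.
assert (H := context_laws_hold); unfold context_laws in H.
repeat rewrite Forall_cons_iff in H; simpl in H.
(* The digits 0, 1, 2 refer to the shapes [Or x e], [Or (Neg (And x d)) e],
   [Or (Neg (And (Neg x) d)) e]. *)
destruct H as (_ & _ & _ & Hor0 & Hand0 & Hneg0 & Hor1 & Hand1 & Hneg2 & Hor2 &
  Hand2 & _).
assert (Ht : forall x y z, indiscernible T x y -> indiscernible T y z ->
  indiscernible T x z).
{ intros x y z (H0 & H1 & H2) (K0 & K1 & K2); repeat split; intros;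
    [apply K0, H0|apply H0, K0|apply K1, H1|apply H1, K1|apply K2, H2|apply H2, K2];
    assumption. }
assert (HandC : forall x y, indiscernible T (And x y) (And y x)).
{ intros x y.
  apply (equation_indiscernible (q := (And (Var 0) (Var 1), And (Var 1) (Var 0)))
           (fun n => nth n [x; y] Bot)); now left. }
assert (HorC : forall x y, indiscernible T (Or x y) (Or y x)).
{ intros x y.
  apply (equation_indiscernible (q := (Or (Var 0) (Var 1), Or (Var 1) (Var 0)))
           (fun n => nth n [x; y] Bot)); right; now left. }
assert (HandL : forall x x' y, indiscernible T x x' ->
  indiscernible T (And x y) (And x' y)).
{ intros x x' y (H0 & H1 & H2); split; [|split]; intros.
  - now rewrite (Hand0 x y Bot e), (Hand0 x' y Bot e), H0.
  - now rewrite (Hand1 x y d e), (Hand1 x' y d e), H1.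
  - now rewrite (Hand2 x y d e), (Hand2 x' y d e), H2. }
assert (HorL : forall x x' y, indiscernible T x x' ->
  indiscernible T (Or x y) (Or x' y)).
{ intros x x' y (H0 & H1 & H2); split; [|split]; intros.
  - now rewrite (Hor0 x y Bot e), (Hor0 x' y Bot e), H0.
  - now rewrite (Hor1 x y d e), (Hor1 x' y d e), H1.
  - now rewrite (Hor2 x y d e), (Hor2 x' y d e), H2. }
split; simpl; auto.
- intros x; repeat split; auto.
- intros x y (H0 & H1 & H2); split; [|split]; intros; symmetry; auto.
(* The right argument is replaced by commuting, replacing on the left, and commuting back. *)
- intros x x' y y' Hx Hy; apply Ht with (And x' y); auto.
  apply Ht with (And y x'); auto; apply Ht with (And y' x'); auto.
- intros x x' y y' Hx Hy; apply Ht with (Or x' y); auto.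
  apply Ht with (Or y x'); auto; apply Ht with (Or y' x'); auto.
- intros x x' (H0 & H1 & H2); split; [|split]; intros.
  (* Negating the hole turns the first shape into the second, the second into the third, and the
     third back into the second. *)
  + now rewrite (Hneg0 x Bot Bot e), (Hneg0 x' Bot Bot e), H1.
  + apply H2.
  + now rewrite (Hneg2 x Bot d e), (Hneg2 x' Bot d e), H1.
Qed.

Lemma quotient_filter (Q : algebra) (q : Fm -> Q) :
  is_hom Fm Q q -> (forall x y, q x = q y <-> indiscernible T x y) ->
  (forall c, exists phi, q phi = c) ->
  nonempty_lattice_filter Q (fun c => exists phi, q phi = c /\ T phi) /\
  (forall phi, (exists psi, q psi = q phi /\ T psi) -> T phi).
Proof.
intros hq qE surj.
assert (H := context_laws_hold); unfold context_laws in H.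
repeat rewrite Forall_cons_iff in H; simpl in H.
destruct H as (Htop & Hand & Hbot & _).
(* Membership of [phi] in [T] amounts to that of [Or phi Bot], a context of the first shape, so [T]
   is a union of classes. *)
assert (back : forall phi, (exists psi, q psi = q phi /\ T psi) -> T phi).
{ intros phi (psi & E1 & Tpsi); apply qE in E1.
  apply (Hbot phi Bot Bot Bot), E1, (Hbot psi Bot Bot Bot); now split. }
split; [split|auto].
- exists top, Top; split; [apply (hom_top hq)|now apply (Htop Bot Bot Bot Bot)].
- intros c c' (phi & <- & Hphi) (psi & <- & Hpsi); exists (And phi psi).
  split; [apply (hom_meet hq)|now apply (Hand phi psi Bot Bot)].
- intros c c' (phi & <- & Hphi) Hc; destruct (surj c') as [psi <-].
  exists psi; split; auto; apply (Hand phi psi Bot Bot), back; exists phi.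
  split; auto; rewrite <- Hc at 1; symmetry; apply (hom_meet hq).
Qed.

End Indiscernibility.

Lemma axiomatizable_of_finitely_based (V : algebra -> Prop) :
  (forall A : algebra, V A -> semi_de_morgan A) ->
  finitely_based V -> finitely_axiomatizable (order_preserving_logic V).
Proof.
intros hSDM [E HE]; exists (flat_map law_rules (laws E)).
intros Gamma phi; split.
- intros HL; set (T := derivable (fun r => In r (flat_map law_rules (laws E))) Gamma).
  assert (hT : closed_under (fun r => In r (flat_map law_rules (laws E))) T).
  { exact (@derivable_closed _ Gamma). }
  destruct (quotient_exists (indiscernible_congruence hT))
    as (Q & q & hq & surj & qE).
  assert (VQ : V Q).
  { apply HE; intros [s t] He h hh.
    (* Choosing preimages of the values of the variables lifts [h] to a substitution, so [h] factors
       through [q]. *)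
    set (v := fun n =>
      proj1_sig (constructive_indefinite_description _ (surj (h (Var n))))).
    assert (hE : forall psi, h psi = q (interp Fm v psi)).
    { intros psi; rewrite (hom_interp (fun n => h (Var n)) psi hh); auto.
      symmetry; apply (hom_interp _ (h := fun psi => q (interp Fm v psi))).
      - apply (hom_comp (interp_hom Fm v) hq).
      - intros n; simpl; unfold v.
        now destruct constructive_indefinite_description. }
    simpl; rewrite !hE; apply qE.
    apply (equation_indiscernible hT (q := (s, t))); right; now right. }
  destruct (quotient_filter hT hq qE surj) as [hF back].
  (* The semantic consequence is tested on [Q], the image of [T] and the quotient map itself. *)
  apply back, (HL Q VQ _ hF q hq).
  intros psi Hpsi; exists psi; split; auto; now apply derivable_premise.
- intros HD A VA F hF h hh HG.
  assert (L : bounded_distributive_lattice A) by apply (hSDM A VA).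
  revert HG HD; apply derivable_least; intros r sigma Hr hs.
  assert (hc := hom_comp hs hh).
  apply in_flat_map in Hr; destruct Hr as ([c l] & Hw & Hr).
  assert (valid : law_valid A (c, l)).
  { apply in_app_or in Hw; destruct Hw as [Hw|Hw].
    - now apply context_laws_valid; [apply hSDM|].
    - apply in_flat_map in Hw; destruct Hw as (e & He & Hw).
      apply (equation_laws_valid (hSDM A VA) (q := e)); auto.
      destruct He as [<-|[<-|He]].
      + apply (sdm_equationsP A); [now apply hSDM|simpl; auto].
      + apply (sdm_equationsP A); [now apply hSDM|simpl; auto].
      + now apply HE. }
  specialize (valid _ hc); simpl in valid.
  (* The law's equation holds in [A], so this equivalence gives soundness of its rules in both
     directions. *)
  assert (cE : F (h (sigma c)) <-> forall psi, In psi l -> F (h (sigma psi))).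
  { rewrite valid; apply (filter_conj L hF l hc). }
  destruct Hr as [<-|Hr]; simpl; [now apply cE|].
  apply in_map_iff in Hr; destruct Hr as (psi & <- & Hpsi); simpl; intros Hc.
  apply cE; auto.
Qed.

Theorem theorem4p7 (V : algebra -> Prop) (hV : variety V)
    (hSDM : forall A : algebra, V A -> semi_de_morgan A) :
  finitely_based V <-> finitely_axiomatizable (order_preserving_logic V).
Proof.
split.
- now apply axiomatizable_of_finitely_based.
- now apply finitely_based_of_axiomatizable.
Qed.
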